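(* For any configuration $c\in\mathcal C$ and distinct programs $f,g\in\mathcal F$, under the simple randomized design ($\alpha$-design) with $n$ runs, conditionally on the event that every program is run at least once ($N_h>0$ for all $h\in\mathcal F$), $$\bar{\mathcal E}_f-\bar{\mathcal E}_g = O_p(n^{-1/2})\qquad (n\to\infty),$$ where $\bar{\mathcal E}_h=\frac{1}{N_h}\sum_{i=1}^n\mathbb 1_{F_i=h}\,\mathcal E_i$ is the average environmental noise over the runs of program $h$.
   Context: Measurement model. $\mathcal F$ is a finite set of programs, $\mathrm F=|\mathcal F|\ge 2$; $\mathcal C$ is a set of configurations. For a fixed configuration $c$, an experiment with $n$ runs generates programs $F_1,\dots,F_n\in\mathcal F$, unobserved uncontrolled states $U_1,U_2,\dots\in\mathcal U$, and real measurements $T_1,\dots,T_n$ sequentially: the initial state $U_1$ is supplied by the environment (arbitrary distribution); at run $i$ the design chooses $F_i$ (using only previously observed variables), then $T_i$ is drawn from a fixed unknown conditional distribution of $T$ given $(U=U_i,F=F_i,c)$, then $U_{i+1}$ is drawn from a fixed unknown conditional distribution given $(T=T_i,U=U_i,F=F_i,c)$. These two conditional distributions depend neither on $i$ nor on the design. Delta design. A design is a delta design if the following hold. (1) Additive global effect: $T_i=\mathcal T_i+\mathcal E_i$, where, conditionally on $F_{\le i},U_{\le i},T_{<i}$, the ''true run time'' $\mathcal T_i$ and the ''environmental noise'' $\mathcal E_i$ are independent, $\mathcal T_i$ has a fixed distribution depending only on $(F_i,c)$, and $\mathcal E_i$ has a fixed distribution depending only on $(U_i,c)$. (In the multiplicative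 version of the assumption, $T,\mathcal T,\mathcal E$ stand for the logarithms of the positive quantities, so the same additive formulation applies.) (2) $T$ is essentially bounded (hence so are $\mathcal T$ and $\mathcal E$, given $c$). (3) $F_i$ is conditionally independent of the earlier measurements and of the configuration given $F_{<i}$ (together with the sequential structure above, $F_i$ depends on the past only through $F_{<i}$), and each $F_i$ has full support $\mathcal F$. (4) The loss estimator is $\hat L(f,c)=\bar T_f=\frac1{N_f}\sum_{i=1}^n \mathbb 1_{F_i=f}T_i$, where $N_f=\sum_{i=1}^n\mathbb 1_{F_i=f}$. Simple randomized design ($\alpha$-design). The delta design in which, for every run $i\in[1,n]$, $F_i$ is chosen uniformly and independently from $\mathcal F$. The run counts are required to satisfy $N_h>0$ for all $h\in\mathcal F$ so that averages are defined; this is the conditioning in the claim. $X_n=O_p(a_n)$ means that $X_n/a_n$ is bounded in probability.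
   Formalization: The true run time and noise of each run are assumed to have their stated conditional laws given also the past true run times and noises, not only the past programs, states and measurements; without this, noises of different runs can be coupled through the programs and the claim fails. *)

(* Defs.v *)
From HB Require Import structures.
From mathcomp Require Import all_boot all_order all_algebra.
From mathcomp Require Import all_classical all_reals all_analysis.

Set Implicit Arguments.
Unset Strict Implicit.
Unset Printing Implicit Defensive.

Import Order.TTheory GRing.Theory Num.Theory.
Import numFieldNormedType.Exports.

Local Open Scope classical_set_scope.
Local Open Scope ring_scope.

(* Runs are numbered from 0: in an experiment with [n] runs, only the variables
   of index [i < n] are meaningful, the others are junk.  In the multiplicative
   setting [meas], [rtime] and [noise] are the logarithms of the quantities. *)
Record run_process (R : realType) (Prog : finType) (dU : measure_display)
    (U : measurableType dU) (dO : measure_display) (Omega : measurableType dO) :=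
  RunProcess {
    prog : nat -> Omega -> Prog ;   (* F_i *)
    state : nat -> Omega -> U ;     (* U_i *)
    meas : nat -> Omega -> R ;      (* T_i *)
    rtime : nat -> Omega -> R ;     (* true run time, latent part of T_i *)
    noise : nat -> Omega -> R       (* environmental noise E_i, latent part of T_i *)
  }.

(* The fixed, unknown laws.  As [Prog] is finite, a kernel with a program among
   its arguments is a family of kernels indexed by [Prog]. *)
Record measurement_model (R : realType) (Conf : Type) (Prog : finType)
    (dU : measure_display) (U : measurableType dU) :=
  MeasurementModel {
    meas_law : Conf -> Prog -> R.-pker U ~> measurableTypeR R ;
      (* T given (U, F, c) *)
    state_law : Conf -> Prog -> R.-pker (measurableTypeR R * U) ~> U ;
      (* next state given (T, U, F, c) *)
    rtime_law : Conf -> Prog -> probability (measurableTypeR R) R ;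
      (* true run time given (F, c) *)
    noise_law : Conf -> R.-pker U ~> measurableTypeR R
      (* noise given (U, c) *)
  }.

Section Designs.
Context (R : realType) (Conf : Type) (Prog : finType).
Context (dU : measure_display) (U : measurableType dU).

Section OneExperiment.
Context (dO : measure_display) (Omega : measurableType dO).
Context (P : probability Omega R) (X : run_process R Prog U Omega).

Definition events_before (T : Type) (S : set (set T)) (Y : nat -> Omega -> T)
    (k : nat) : set (set Omega) :=
  [set A | exists i B, [/\ (i < k)%N, S B & A = Y i @^-1` B]].

(* sigma-algebra of what is generated by the first [kF] programs, [kU] states
   and [kT] measurements; a measurement is generated together with its two
   latent parts, which therefore belong to the history. *)
Definition history (kF kU kT : nat) : set (set Omega) :=
  <<s events_before [set: set Prog] (prog X) kF
      `|` events_before measurable (state X) kU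
      `|` events_before (@measurable _ (measurableTypeR R)) (meas X) kT
      `|` events_before (@measurable _ (measurableTypeR R)) (rtime X) kT
      `|` events_before (@measurable _ (measurableTypeR R)) (noise X) kT >>.

(* [k w] is a version of the conditional law of [Y] given the sigma-algebra
   [H].  In all uses [k w] is a kernel evaluated at [H]-measurable variables. *)
Definition has_cond_law (H : set (set Omega)) (d : measure_display)
    (T : measurableType d) (Y : Omega -> T) (k : Omega -> set T -> \bar R) :=
  forall A B, H A -> measurable B ->
    P (A `&` Y @^-1` B) = (\int[P]_(w in A) k w B)%E.

(* [Y] and [Z] are conditionally independent given [H], with conditional laws
   [k] and [l]. *)
Definition has_cond_indep_laws (H : set (set Omega))
    (d1 d2 : measure_display) (T1 : measurableType d1) (T2 : measurableType d2)
    (Y : Omega -> T1) (Z : Omega -> T2)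
    (k : Omega -> set T1 -> \bar R) (l : Omega -> set T2 -> \bar R) :=
  forall A B C, H A -> measurable B -> measurable C ->
    P (A `&` Y @^-1` B `&` Z @^-1` C) = (\int[P]_(w in A) (k w B * l w C))%E.

(* A policy [q] gives, at run [i] and after the programs [s] of the runs
   before [i], the probability [q i s f] of choosing [f].  It depends neither
   on the measurements nor on the configuration. *)
Record is_policy (q : nat -> seq Prog -> Prog -> R) : Prop := IsPolicy {
  policy_ge0 : forall i s f, 0 <= q i s f ;
  policy_sum1 : forall i s, \sum_(f : Prog) q i s f = 1
}.

(* The law of the initial state [state X 0] is unconstrained. *)
Record delta_experiment (M : measurement_model R Conf Prog U) (c : Conf)
    (q : nat -> seq Prog -> Prog -> R) (n : nat) : Prop := DeltaExperiment {
  prog_measurable : forall i (f : Prog), (i < n)%N ->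
    measurable (prog X i @^-1` [set f]) ;
  state_measurable : forall i, (i < n)%N -> measurable_fun setT (state X i) ;
  rtime_measurable : forall i, (i < n)%N ->
    measurable_fun setT (rtime X i : Omega -> measurableTypeR R) ;
  noise_measurable : forall i, (i < n)%N ->
    measurable_fun setT (noise X i : Omega -> measurableTypeR R) ;
  prog_choice : forall i (f : Prog) A, (i < n)%N -> history i i.+1 i A ->
    P (A `&` prog X i @^-1` [set f]) =
      (\int[P]_(w in A) (q i (mkseq (fun j => prog X j w) i) f)%:E)%E ;
  prog_full_support : forall i (f : Prog), (i < n)%N ->
    (0 < P (prog X i @^-1` [set f]))%E ;
  meas_cond_law : forall i, (i < n)%N ->
    has_cond_law (history i.+1 i.+1 i) (meas X i : Omega -> measurableTypeR R)
      (fun w => meas_law M c (prog X i w) (state X i w)) ;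
  state_cond_law : forall i, (i.+1 < n)%N ->
    has_cond_law (history i.+1 i.+1 i.+1) (state X i.+1)
      (fun w => state_law M c (prog X i w) (meas X i w, state X i w)) ;
  additive_effect : forall i w, (i < n)%N ->
    meas X i w = rtime X i w + noise X i w ;
  rtime_noise_cond_law : forall i, (i < n)%N ->
    has_cond_indep_laws (history i.+1 i.+1 i)
      (rtime X i : Omega -> measurableTypeR R)
      (noise X i : Omega -> measurableTypeR R)
      (fun w => rtime_law M c (prog X i w))
      (fun w => noise_law M c (state X i w))
}.

Definition run_count (n : nat) (h : Prog) (w : Omega) : nat :=
  (\sum_(i < n) (prog X i w == h))%N.

(* Average of [Y] over the runs of [h] ([0] when there is none); for [meas X]
   this is the loss estimator, for [noise X] the average noise. *)
Definition run_avg (n : nat) (Y : nat -> Omega -> R) (h : Prog) (w : Omega) : R :=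
  (run_count n h w)%:R^-1 * \sum_(i < n) (prog X i w == h)%:R * Y i w.

Definition all_run (n : nat) : set Omega :=
  [set w | forall h, (0 < run_count n h w)%N].

End OneExperiment.

(* A design is studied as n grows, so it is a family indexed by the number of
   runs.  The experiments for different n may live on different probability
   spaces, with different laws of the initial state; the conditional laws in
   [M] and the essential bound of T do not depend on n or on the run. *)
Definition delta_design (dO : nat -> measure_display)
    (Omega : forall n, measurableType (dO n))
    (P : forall n, probability (Omega n) R)
    (X : forall n, run_process R Prog U (Omega n))
    (M : measurement_model R Conf Prog U) (c : Conf)
    (q : nat -> nat -> seq Prog -> Prog -> R) : Prop :=
  [/\ forall n, is_policy (q n),
      forall n, delta_experiment (P n) (X n) M c (q n) n &
      exists B : R, forall n i, (i < n)%N ->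
        {ae P n, forall w, `|meas (X n) i w| <= B} ].

Definition uniform_policy (n i : nat) (s : seq Prog) (f : Prog) : R :=
  #|Prog|%:R^-1.

(* By [prog_choice], a constant policy makes every choice of program uniform
   and independent of the whole history. *)
Definition alpha_design (dO : nat -> measure_display)
    (Omega : forall n, measurableType (dO n))
    (P : forall n, probability (Omega n) R)
    (X : forall n, run_process R Prog U (Omega n))
    (M : measurement_model R Conf Prog U) (c : Conf) : Prop :=
  delta_design P X M c uniform_policy.

End Designs.

(* Only meaningful when [P A] is nonzero (the value is 0 otherwise). *)
Definition cond_pr (R : realType) (d : measure_display) (T : measurableType d)
    (P : probability T R) (A B : set T) : \bar R :=
  (P (B `&` A) * ((fine (P A))^-1)%:E)%E.

(* X_n = O_p(a_n) for X_n under the set function Q_n (a probability, for all n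
   large enough). *)
Definition big_O_p (R : realType) (dO : nat -> measure_display)
    (Omega : forall n, measurableType (dO n))
    (Q : forall n, set (Omega n) -> \bar R)
    (X : forall n, Omega n -> R) (a : nat -> R) : Prop :=
  forall eps : R, 0 < eps -> exists K : R, 0 < K /\
    \forall n \near \oo,
      (Q n [set w | (K < `|X n w / a n|)%R] <= eps%:E)%E.

(* Main.v *)
(* Let p = 1/|F|, m the mean noise over all runs, V_f = N_f - np and
   S_f = sum_i (1_{F_i = f} - p) E_i.  Then bar E_f - m = (S_f - V_f m) / N_f.
   In the alpha-design F_i is uniform and independent of E_i and of the past, so
   both V_f and S_f are sums of martingale differences; these are bounded because
   E_i is essentially bounded uniformly in i and n, hence V_f and S_f are
   O_p(n^{1/2}) by Chebyshev, while N_f is of order n.  The mean m cancels in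
   bar E_f - bar E_g, and the conditioning is harmless because every program is
   run with probability tending to 1. *)
Require Import Defs.
From HB Require Import structures.
From mathcomp Require Import all_boot all_order all_algebra.
From mathcomp Require Import all_classical all_reals all_analysis.
From mathcomp Require Import measurable_realfun ring lra.

Set Implicit Arguments.
Unset Strict Implicit.
Unset Printing Implicit Defensive.

Import Order.TTheory GRing.Theory Num.Theory.
Import numFieldNormedType.Exports.

Local Open Scope classical_set_scope.
Local Open Scope ring_scope.

(** * Measurable comparison sets, and integration against restricted or proportional laws *)

Section comparison_sets.
Context (R : realType) (d : measure_display) (T : measurableType d).
Variables (f g : T -> R).
Hypotheses (mf : measurable_fun setT f) (mg : measurable_fun setT g).

Lemma measurable_set_ler : measurable [set x | f x <= g x].
Proof.
have /(_ measurableT [set true] Logic.I) := measurable_fun_ler mf mg.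
by rewrite setTI.
Qed.

Lemma measurable_set_ltr : measurable [set x | f x < g x].
Proof.
have /(_ measurableT [set true] Logic.I) := measurable_fun_ltr mf mg.
by rewrite setTI.
Qed.

End comparison_sets.

Lemma measurable_fun_nat_of_bool (R : realType) (d : measure_display)
    (T : measurableType d) (a : T -> bool) :
  measurable [set x | a x] ->
  measurable_fun setT (fun x => (a x)%:R : R).
Proof.
move=> ma; rewrite (_ : (fun x => _) = \1_[set x | a x]).
  exact: measurable_indic.
apply/funext => x; rewrite indicE; congr (_%:R).
by case E : (a x); [rewrite mem_set|rewrite memNset//= E].
Qed.

(** The restricted measure agrees with [mu] on [A] and vanishes off [A]. An integral over an event
    thus becomes one over the whole space, where a change of variables by pushforward applies. *)
Lemma ge0_integral_mrestr (R : realType) (d : measure_display)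
    (T : measurableType d) (mu : {measure set T -> \bar R}) (A : set T)
    (mA : measurable A) (phi : T -> \bar R) :
  measurable_fun setT phi -> (forall x, (0 <= phi x)%E) ->
  (\int[mrestr mu mA]_x phi x = \int[mu]_(x in A) phi x)%E.
Proof.
move=> mphi phi0; rewrite -(setUv A) ge0_integral_setU//=; last 3 first.
- exact: measurableC.
- by rewrite setUv.
- by apply/disj_setPS; rewrite setICr.
rewrite (eq_measure_integral mu); last first.
  by move=> B mB BA; rewrite /= /mrestr setIidl.
rewrite [X in (_ + X)%E](eq_measure_integral mzero); last first.
  move=> B mB BA; rewrite /= /mrestr /mzero.
  by rewrite (disjoints_subset _ _).2 ?measure0.
by rewrite integral_measure_zero adde0.
Qed.

Section scaled_law.
Context (R : realType) (d d' : measure_display) (Omega : measurableType d)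
  (T : measurableType d') (P : probability Omega R).
Variables (Y : Omega -> T) (mY : measurable_fun setT Y).
Variables (A1 A2 : set Omega) (mA1 : measurable A1) (mA2 : measurable A2).
Variables (p : R) (p0 : 0 <= p).
Hypothesis lawE : forall B, measurable B ->
  P (A1 `&` Y @^-1` B) = (p%:E * P (A2 `&` Y @^-1` B))%E.

(** By [lawE], the image under [Y] of [P] restricted to [A1] is [p] times the image of [P]
    restricted to [A2]; integrals of functions of [Y] inherit this factor. *)
Lemma ge0_integral_scaled_law (phi : T -> \bar R) :
  measurable_fun setT phi -> (forall y, (0 <= phi y)%E) ->
  (\int[P]_(w in A1) phi (Y w) = p%:E * \int[P]_(w in A2) phi (Y w))%E.
Proof.
move=> mphi phi0.
have mphiY : measurable_fun setT (phi \o Y) by exact: measurableT_comp.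
have phiY0 w : (0 <= (phi \o Y) w)%E by exact: phi0.
rewrite -(ge0_integral_mrestr P mA1 mphiY phiY0).
rewrite -(ge0_integral_mrestr P mA2 mphiY phiY0).
rewrite -(@ge0_integral_pushforward _ _ _ _ _ _ mY (mrestr P mA1) setT phi)//.
rewrite -(@ge0_integral_pushforward _ _ _ _ _ _ mY (mrestr P mA2) setT phi)//.
rewrite -(ge0_integral_mscale _ _ (NngNum p0))//.
apply: eq_measure_integral => B mB _ /=.
by rewrite /mscale /= /pushforward /= /mrestr /= !(setIC (Y @^-1` B)) lawE.
Qed.

(** The nonnegative case applies to the positive and negative parts; integrability lets [p]
    distribute over their difference. *)
Lemma integral_scaled_law (phi : T -> R) :
  measurable_fun setT phi -> P.-integrable setT (EFin \o (phi \o Y)) ->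
  (\int[P]_(w in A1) (phi (Y w))%:E =
    p%:E * \int[P]_(w in A2) (phi (Y w))%:E)%E.
Proof.
move=> mphi iphi.
have mE : measurable_fun setT (EFin \o phi) by exact/measurable_EFinP.
have iA2 : P.-integrable A2 (EFin \o (phi \o Y)).
  exact: (integrableS measurableT).
change (\int[P]_(w in A1) ((EFin \o phi) \o Y) w =
  p%:E * \int[P]_(w in A2) ((EFin \o phi) \o Y) w)%E.
rewrite integralE [in RHS]integralE muleBr//; last first.
  by apply: fin_num_adde_defr; exact: integrable_pos_fin_num.
have := @ge0_integral_scaled_law _ (measurable_funepos mE) (funepos_ge0 _).
have := @ge0_integral_scaled_law _ (measurable_funeneg mE) (funeneg_ge0 _).
move=> e1 e2; rewrite funepos_comp funeneg_comp.
by congr (_ - _)%E.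
Qed.

End scaled_law.

(* The summands [((b i w)%:R - p) * Y i w] are martingale differences as soon as
   the event [b i], of probability [p], is independent of [Y i] times the sum of
   the previous ones; the cross terms of the second moment then vanish. *)
Section second_moment.
Context (R : realType) (d : measure_display) (Omega : measurableType d)
  (P : probability Omega R).
Variables (n : nat) (p K : R) (b : nat -> Omega -> bool) (Y : nat -> Omega -> R).
Hypotheses (p01 : 0 <= p <= 1) (K0 : 0 <= K).
Hypothesis mb : forall i, (i < n)%N -> measurable [set w | b i w].
Hypothesis mY : forall i, (i < n)%N -> measurable_fun setT (Y i).
Hypothesis YK : forall i w, (i < n)%N -> `|Y i w| <= K.

Definition centered_sum (m : nat) (w : Omega) : R :=
  \sum_(i < m) ((b i w)%:R - p) * Y i w.

Hypothesis bE : forall i B, (i < n)%N -> measurable B ->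
  P ([set w | b i w] `&` (fun w => centered_sum i w * Y i w) @^-1` B) =
  (p%:E * P ((fun w => (centered_sum i w * Y i w)%R) @^-1` B))%E.

Lemma measurable_centered_sum (m : nat) :
  (m <= n)%N -> measurable_fun setT (centered_sum m).
Proof.
move=> mn; apply: measurable_sum => i.
have iN : (i < n)%N := leq_trans (ltn_ord i) mn.
apply: measurable_funM; last exact: mY.
apply: measurable_funB => //.
exact/measurable_fun_nat_of_bool/mb.
Qed.

Let D_le (i : nat) (w : Omega) :
  (i < n)%N -> `|((b i w)%:R - p) * Y i w| <= K.
Proof.
move=> iN; rewrite normrM -[leRHS]mul1r ler_pM ?YK//.
by case/andP: p01 => p0 p1; case: (b i w); rewrite ler_norml /=; apply/andP; split; lra.
Qed.

Lemma centered_sum_le (m : nat) (w : Omega) :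
  (m <= n)%N -> `|centered_sum m w| <= m%:R * K.
Proof.
move=> mn; rewrite (le_trans (ler_norm_sum _ _ _))//.
rewrite (_ : _%:R * K = \sum_(i < m) K); last by rewrite sumr_const card_ord mulr_natl.
by apply: ler_sum => i _; apply: D_le; exact: leq_trans (ltn_ord i) mn.
Qed.

Let bounded_int (g : Omega -> R) (C : R) : measurable_fun setT g ->
  (forall w, `|g w| <= C) -> P.-integrable setT (EFin \o g).
Proof.
move=> mg gC; apply: measurable_bounded_integrable => //.
  by rewrite (le_lt_trans (@probability_le1 _ _ _ P _ measurableT)) ?ltry.
exists C; split; first exact: num_real.
by move=> x Cx w _; rewrite /= (le_trans (gC w))// ltW.
Qed.

Lemma second_moment_centered_sum (m : nat) : (m <= n)%N ->
  \int[P]_w (centered_sum m w ^+ 2) <= m%:R * K ^+ 2.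
Proof.
elim: m => [_|m IH mn].
  rewrite mul0r (_ : (fun w => _) = cst 0); last first.
    by apply/funext => w; rewrite /centered_sum big_ord0 expr0n.
  by rewrite Rintegral_cst// mul0r.
have mn' := ltnW mn.
(* [Z] carries the cross term: the square at [m.+1] is the square at [m], plus twice [b m - p] times
   [Z], plus [D ^+ 2]. *)
pose Z w := centered_sum m w * Y m w.
pose D w := ((b m w)%:R - p) * Y m w.
have mZ : measurable_fun setT Z.
  by apply: measurable_funM; [exact: measurable_centered_sum|exact: mY].
have mI : measurable_fun setT (fun w => (b m w)%:R : R).
  exact/measurable_fun_nat_of_bool/mb.
have mD : measurable_fun setT D.
  by apply: measurable_funM; [exact: measurable_funB|exact: mY].
have iZ : P.-integrable setT (EFin \o Z).
  apply: (@bounded_int _ (m%:R * K * K)) => // w.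
  by rewrite normrM ler_pM ?YK ?centered_sum_le.
have iIZ : P.-integrable setT (EFin \o (fun w => (b m w)%:R * Z w)).
  apply: (@bounded_int _ (m%:R * K * K)); first exact: measurable_funM.
  move=> w; rewrite normrM -[leRHS]mul1r ler_pM//.
    by case: (b m w); rewrite ?normr1 ?normr0.
  by rewrite normrM ler_pM ?YK ?centered_sum_le.
have ipZ : P.-integrable setT (EFin \o (fun w => p * Z w)).
  exact: (integrableZl measurableT p iZ).
have iS2 : P.-integrable setT (EFin \o (fun w => centered_sum m w ^+ 2)).
  apply: (@bounded_int _ ((m%:R * K) ^+ 2)).
    by apply: measurable_funX; exact: measurable_centered_sum.
  by move=> w; rewrite normrX ler_pXn2r ?nnegrE ?mulr_ge0 ?centered_sum_le.
have iD2 : P.-integrable setT (EFin \o (fun w => D w ^+ 2)).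
  apply: (@bounded_int _ (K ^+ 2)); first exact: measurable_funX.
  by move=> w; rewrite normrX ler_pXn2r ?nnegrE ?D_le.
(* By [bE], the integral of [Z] over the event [b m] is [p] times its integral over the whole
   space. *)
have cross0 : \int[P]_w ((b m w)%:R * Z w - p * Z w) = 0.
  rewrite RintegralB// RintegralZl//; apply/eqP; rewrite subr_eq0; apply/eqP.
  transitivity (\int[P]_(w in [set w | b m w]) Z w).
    rewrite [RHS]Rintegral_mkcond; apply: eq_Rintegral => w _.
    rewrite /patch; case: ifPn => [|]; first by rewrite inE /= => ->; rewrite mul1r.
    by rewrite notin_setE /= => /negP/negbTE ->; rewrite mul0r.
  rewrite /Rintegral (@integral_scaled_law R d _ Omega _ P Z mZ [set w | b m w] setT
    (mb mn) measurableT p _ _ id)//.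
  - by rewrite fineM//; exact: integrable_fin_num.
  - by case/andP: p01.
  - by move=> B mB; rewrite setTI; exact: bE.
have icross : P.-integrable setT (EFin \o (fun w => (b m w)%:R * Z w - p * Z w)).
  exact: (integrableB measurableT iIZ ipZ).
have icross2 :
    P.-integrable setT (EFin \o (fun w => 2 * ((b m w)%:R * Z w - p * Z w))).
  exact: (integrableZl measurableT 2 icross).
have -> : \int[P]_w (centered_sum m.+1 w ^+ 2) =
    \int[P]_w (centered_sum m w ^+ 2 + 2 * ((b m w)%:R * Z w - p * Z w) + D w ^+ 2).
  apply: eq_Rintegral => w _; rewrite /centered_sum big_ord_recr /=.
  by rewrite -/(centered_sum m w) /Z /D; ring.
rewrite RintegralD//; last exact: (integrableD measurableT iS2 icross2).
rewrite RintegralD// RintegralZl// cross0 mulr0 addr0.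
rewrite -natr1 mulrDl mul1r lerD ?IH//.
rewrite (@le_trans _ _ (\int[P]_w cst (K ^+ 2) w))//.
  apply: le_Rintegral => //; first exact: finite_measure_integrable_cst.
  move=> w _; rewrite -real_normK ?num_real//.
  by rewrite ler_pXn2r ?nnegrE ?D_le.
rewrite Rintegral_cst// [X in _ * X](_ : _ = 1) ?mulr1//.
exact: (congr1 fine (probability_setT P)).
Qed.

Lemma chebyshev_centered_sum (a : R) : 0 < a ->
  (P [set w | (a <= `|centered_sum n w|)%R] <= (n%:R * K ^+ 2 / a ^+ 2)%:E)%E.
Proof.
move=> a0; have mS := measurable_centered_sum (leqnn n).
have mS2 : measurable_fun setT (fun w => centered_sum n w ^+ 2).
  exact: measurable_funX.
have mA : measurable [set w | (a <= `|centered_sum n w|)%R].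
  by apply: measurable_set_ler => //; exact: measurableT_comp.
rewrite mulrC EFinM lee_pdivlMl ?exprn_gt0//.
rewrite (@le_trans _ _ (\int[P]_w (centered_sum n w ^+ 2)%:E)%E)//; last first.
  rewrite -[leLHS]fineK; first by rewrite lee_fin second_moment_centered_sum.
  apply: integrable_fin_num => //.
  apply: (@bounded_int _ ((n%:R * K) ^+ 2)) => // w.
  by rewrite normrX ler_pXn2r ?nnegrE ?mulr_ge0 ?centered_sum_le.
rewrite -integral_cst//.
apply: (@le_trans _ _ (\int[P]_(w in [set w | (a <= `|centered_sum n w|)%R])
    (centered_sum n w ^+ 2)%:E)%E).
  apply: ge0_le_integral => //.
  - by move=> w _; rewrite lee_fin exprn_ge0 ?ltW.
  - by apply/measurable_EFinP; exact: measurable_funTS.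
  - move=> w /= aw; rewrite lee_fin -[leRHS]real_normK ?num_real//.
    by rewrite ler_pXn2r ?nnegrE//; exact: ltW.
apply: ge0_subset_integral => //; first exact/measurable_EFinP.
by move=> w _; rewrite lee_fin sqr_ge0.
Qed.

End second_moment.

(** * Union bound, mass of bounded sets, and a deterministic bound on sample means *)

Lemma measure_bigsetU_le (d : measure_display) (T : measurableType d)
    (R : realType) (mu : {measure set T -> \bar R}) (I : Type) (s : seq I)
    (F : I -> set T) : (forall i, measurable (F i)) ->
  (mu (\big[setU/set0]_(i <- s) F i) <= \sum_(i <- s) mu (F i))%E.
Proof.
move=> mF; elim: s => [|i s IH]; first by rewrite !big_nil measure0.
rewrite !big_cons (le_trans (measureU2 _ _ _))//; last exact: leeD2l.
exact: bigsetU_measurable.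
Qed.

(** Otherwise every ball of integer radius would be null, hence also their countable union, which is
    the whole line. *)
Lemma probability_bounded_gt0 (R : realType)
    (mu : probability (measurableTypeR R) R) :
  exists L : R, (0 < mu [set x | (`|x| <= L)%R])%E.
Proof.
apply: contrapT => noL.
have mB (L : R) : measurable [set x : measurableTypeR R | `|x| <= L].
  by apply: measurable_set_ler => //; exact: measurableT_comp.
have : mu.-negligible (\bigcup_(k : nat) [set x : measurableTypeR R | `|x| <= k%:R]).
  apply: negligible_bigcup => k; apply/negligibleP => //; apply/eqP.
  rewrite eq_le measure_ge0 andbT leNgt; apply/negP => kpos.
  by apply: noL; exists k%:R.
rewrite (_ : \bigcup_k _ = setT); last first.
  rewrite -subTset => x _; exists (Num.bound `|x|) => //=.
  by rewrite ltW// archi_boundP.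
move/negligibleP => /(_ measurableT) muT0.
by have := probability_setT mu; rewrite muT0 => /esym/eqP; rewrite onee_eq0.
Qed.

(** Substituting [N] and [A] turns the difference into [(n * S - V * T) / (N * n)]. The numerator is
    at most [2 * n * K * L * s], and [N >= n * p / 2] because [V] is at most half of [n * p] in
    absolute value. In use, [N] and [A] are the count and the noise total of one program, and [T] is
    the noise total of all runs. *)
Lemma sample_mean_deviation (R : realFieldType) (p n N A S V T K L s : R) :
  0 < p -> 0 < s -> 0 <= K -> 0 <= L -> n = s ^+ 2 -> L * s <= n * p / 2 ->
  N = V + n * p -> A = S + p * T ->
  `|V| <= L * s -> `|S| <= K * L * s -> `|T| <= n * K ->
  `|N^-1 * A - T / n| <= 4 * K * L / (p * s).
Proof.
move=> p0 s0 K0 L0 nE Lsn NE AE VL SL TK.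
have n0 : 0 < n by rewrite nE exprn_gt0.
have N2 : n * p / 2 <= N.
  by rewrite NE; move: VL; rewrite ler_norml => /andP[? _]; lra.
have np0 : 0 < n * p / 2 by rewrite divr_gt0 ?mulr_gt0.
have N0 : 0 < N by exact: lt_le_trans N2.
have -> : N^-1 * A - T / n = (n * S - V * T) / (N * n).
  by rewrite AE NE; field; rewrite -NE !gt_eqF.
rewrite normrM normfV (gtr0_norm (mulr_gt0 N0 n0)) ler_pdivrMr ?mulr_gt0//.
rewrite (@le_trans _ _ (2 * n * K * L * s))//.
  rewrite (le_trans (ler_normB _ _))// !normrM (gtr0_norm n0).
  rewrite (_ : 2 * n * K * L * s = n * (K * L * s) + L * s * (n * K)); last by ring.
  by apply: lerD; apply: ler_pM => //; exact: ltW.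
rewrite (_ : 2 * n * K * L * s = 4 * K * L / (p * s) * (n * p / 2 * n)); last first.
  by rewrite nE; field; rewrite !gt_eqF.
apply: ler_wpM2l; last by apply: ler_wpM2r => //; exact: ltW.
by apply: divr_ge0; rewrite mulr_ge0 ?mulr_ge0//; exact: ltW.
Qed.

(** * The sigma-algebras of the history *)

Section history.
Context (R : realType) (Prog : finType) (dU : measure_display)
  (U : measurableType dU) (dO : measure_display) (Omega : measurableType dO)
  (X : run_process R Prog U Omega).

Lemma preimage_prog1 (i : nat) (h : Prog) :
  [set w | prog X i w == h] = prog X i @^-1` [set h].
Proof. by apply/seteqP; split => w /= /eqP. Qed.

Lemma history_prog (kF kU kT i : nat) (B : set Prog) :
  (i < kF)%N -> history X kF kU kT (prog X i @^-1` B).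
Proof.
by move=> ik; apply: sub_gen_smallest; do 4 left; exists i, B.
Qed.

Lemma history_state (kF kU kT i : nat) (B : set U) :
  (i < kU)%N -> measurable B -> history X kF kU kT (state X i @^-1` B).
Proof.
by move=> ik mB; apply: sub_gen_smallest; do 3 left; right; exists i, B.
Qed.

Lemma history_noise (kF kU kT i : nat) (B : set (measurableTypeR R)) :
  (i < kT)%N -> measurable B -> history X kF kU kT (noise X i @^-1` B).
Proof.
by move=> ik mB; apply: sub_gen_smallest; right; exists i, B.
Qed.

Lemma sub_history (kF kU kT kF' kU' kT' : nat) :
  (kF <= kF')%N -> (kU <= kU')%N -> (kT <= kT')%N ->
  history X kF kU kT `<=` history X kF' kU' kT'.
Proof.
move=> kFF kUU kTT; apply: sub_sigma_algebra2.
have mono T (S : set (set T)) Y (k k' : nat) : (k <= k')%N ->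
    events_before S Y k `<=` (events_before S Y k' : set (set Omega)).
  move=> kk A [i [B [ik SB ->]]]; exists i, B; split => //.
  exact: leq_trans kk.
by do 4 ?apply: setUSS; exact: mono.
Qed.

Lemma historyI (kF kU kT : nat) (A B : set Omega) :
  history X kF kU kT A -> history X kF kU kT B ->
  history X kF kU kT (A `&` B).
Proof. exact: (@measurableI _ (g_sigma_algebraType _)). Qed.

End history.

(** * Independence and deviation bounds under the uniform policy *)

Section uniform_policy_experiment.
Context (R : realType) (Conf : Type) (Prog : finType) (dU : measure_display)
  (U : measurableType dU) (M : measurement_model R Conf Prog U) (c : Conf)
  (dO : measure_display) (Omega : measurableType dO)
  (P : probability Omega R) (X : run_process R Prog U Omega) (n : nat).
Hypothesis hX : delta_experiment P X M c (@uniform_policy R Prog n) n.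

Lemma measurable_prog (i : nat) (B : set Prog) :
  (i < n)%N -> measurable (prog X i @^-1` B).
Proof.
move=> iN; rewrite (_ : _ @^-1` B = \bigcup_(h in B) (prog X i @^-1` [set h])).
  apply: fin_bigcup_measurable; first exact: finite_finset.
  by move=> h _; exact: (prog_measurable hX).
apply/seteqP; split => [w Bw|w [h Bh /= wh]]; first by exists (prog X i w).
by rewrite /= wh.
Qed.

Lemma history_measurable (kF kU kT : nat) :
  (kF <= n)%N -> (kU <= n)%N -> (kT <= n)%N ->
  history X kF kU kT `<=` measurable.
Proof.
move=> kFn kUn kTn; apply: smallest_sub; first exact: sigma_algebra_measurable.
move=> A [[[[|]|]|]|] [i [B [ik mB ->]]].
- by apply: measurable_prog; exact: leq_trans kFn.
- rewrite -[X in measurable X]setTI.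
  by apply: (state_measurable hX) => //; exact: leq_trans kUn.
- have iN : (i < n)%N by exact: leq_trans kTn.
  rewrite -[X in measurable X]setTI.
  (* Measurability of a measurement is derived from that of its two latent parts. *)
  rewrite (_ : meas X i = rtime X i \+ noise X i).
    apply: measurable_funD => //; first exact: (rtime_measurable hX).
    exact: (noise_measurable hX).
  by apply/funext => w; rewrite (additive_effect hX).
- rewrite -[X in measurable X]setTI.
  by apply: (rtime_measurable hX) => //; exact: leq_trans kTn.
- rewrite -[X in measurable X]setTI.
  by apply: (noise_measurable hX) => //; exact: leq_trans kTn.
Qed.

Let p : R := #|Prog|%:R^-1.

Lemma prog_uniform (i : nat) (f : Prog) (A : set Omega) :
  (i < n)%N -> history X i i.+1 i A ->
  P (A `&` prog X i @^-1` [set f]) = (p%:E * P A)%E.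
Proof.
move=> iN hA; rewrite (prog_choice hX)//.
transitivity (\int[P]_(w in A) cst p%:E w)%E; first by [].
rewrite integral_cst//.
by apply: history_measurable hA => //; exact: ltnW.
Qed.

(** This is a marginal of the joint conditional law: with the true run time unconstrained, its
    factor is 1. *)
Lemma noise_law_history (i : nat) (A : set Omega) (C : set (measurableTypeR R)) :
  (i < n)%N -> history X i.+1 i.+1 i A -> measurable C ->
  P (A `&` noise X i @^-1` C) =
    (\int[P]_(w in A) noise_law M c (state X i w) C)%E.
Proof.
move=> iN hA mC.
have := rtime_noise_cond_law hX iN hA measurableT mC.
rewrite preimage_setT setIT => ->; apply: eq_integral => w _.
by rewrite probability_setT mul1e.
Qed.

(** The noise is drawn from a law that depends on the state only, so both sides are integrals of one
    function of [state X i]. Since [A] and the state precede the choice of program, imposing [f]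
    multiplies the law of the state on [A] by [p]. *)
Lemma prog_noise_independent (i : nat) (f : Prog) (A : set Omega)
    (C : set (measurableTypeR R)) :
  (i < n)%N -> history X i i.+1 i A -> measurable C ->
  P (prog X i @^-1` [set f] `&` (A `&` noise X i @^-1` C)) =
    (p%:E * P (A `&` noise X i @^-1` C))%E.
Proof.
move=> iN hA mC.
have hA' : history X i.+1 i.+1 i A by apply: sub_history hA.
have mA : measurable A by apply: history_measurable hA => //; exact: ltnW.
have hF : history X i.+1 i.+1 i (prog X i @^-1` [set f]) by exact: history_prog.
rewrite setIA (setIC _ A) noise_law_history//; last exact: historyI.
rewrite noise_law_history//.
apply: (ge0_integral_scaled_law (state_measurable hX iN) _ _ _ _
  (measurable_kernel (noise_law M c) C mC)) => //.
- by apply: measurableI => //; exact: measurable_prog.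
- by rewrite invr_ge0.
- move=> B mB; rewrite setIAC prog_uniform//.
  by apply: historyI => //; exact: history_state.
Qed.

Section noise_function.
Context (phi : measurableTypeR R -> R) (f : Prog).
Hypothesis mphi : measurable_fun setT phi.

Let b (i : nat) (w : Omega) := prog X i w == f.
Let Y (i : nat) (w : Omega) := phi (noise X i w).

(** Two finite measures that agree on a generating pi-system are equal, so the independence known
    for a past event intersected with a noise event extends to every event determined by the past
    and the current noise. This provides the hypothesis [bE] of the second moment bound. *)
Lemma prog_centered_sum_independent (i : nat) (B : set R) :
  (i < n)%N -> measurable B ->
  P ([set w | prog X i w == f] `&`
     (fun w => (centered_sum p b Y i w * Y i w)%R) @^-1` B) =
  (p%:E * P ((fun w => (centered_sum p b Y i w * Y i w)%R) @^-1` B))%E.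
Proof.
move=> iN mB.
pose Z w := centered_sum p b Y i w * Y i w.
(* A pi-system generating the sigma-algebra of the history before the choice of
   [prog X i] together with the noise of run [i]. *)
pose G := [set D | exists A C, [/\ history X i i.+1 i A,
  measurable (C : set (measurableTypeR R)) & D = A `&` noise X i @^-1` C]].
have HT : history X i i.+1 i setT by exact: (@measurableT _ (g_sigma_algebraType _)).
have sHG A : history X i i.+1 i A -> <<s G >> A.
  by move=> hA; apply: sub_gen_smallest; exists A, setT; rewrite preimage_setT setIT.
have mG : G `<=` measurable.
  move=> _ [A [C [hA mC ->]]]; apply: measurableI.
    by apply: history_measurable hA => //; exact: ltnW.
  by rewrite -[X in measurable X]setTI; exact: (noise_measurable hX).
(* The noise of run [i] comes from the second component of the members of [G], the earlier ones from
   the history. *)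
have mY j : (j <= i)%N ->
    measurable_fun setT (Y j : g_sigma_algebraType G -> R).
  move=> ji; apply: (measurableT_comp mphi) => _ C mC; rewrite setTI.
  move: ji; rewrite leq_eqVlt => /predU1P[->|ji].
    by apply: sub_gen_smallest; exists setT, C; rewrite setTI.
  by apply: sHG; exact: history_noise.
have mZ : measurable_fun setT (Z : g_sigma_algebraType G -> R).
  apply: measurable_funM; last exact: mY.
  (* The measurability lemma is used here over the sigma-algebra generated by [G], not the ambient
     one. *)
  apply: (@measurable_centered_sum _ _ _ i) => // j ji; last by apply: mY; exact: ltnW.
  rewrite [X in _ X](preimage_prog1 X j f); apply: sHG; exact: history_prog.
have sZ : <<s G >> (Z @^-1` B) by rewrite -[X in _ X]setTI; exact: mZ.
have mf : measurable (prog X i @^-1` [set f]) by exact: measurable_prog.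
have p0 : 0 <= p by rewrite invr_ge0.
rewrite preimage_prog1.
transitivity (mrestr P mf (Z @^-1` B)); first by rewrite /mrestr /= setIC.
transitivity (mscale (NngNum p0) P (Z @^-1` B)); last by [].
apply: (g_sigma_algebra_measure_unique G mG (fun=> setT)) => //.
- by move=> _; exists setT, setT; rewrite preimage_setT setIT.
- by rewrite bigcup_const.
- move=> _ _ [A1 [C1 [hA1 mC1 ->]]] [A2 [C2 [hA2 mC2 ->]]].
  exists (A1 `&` A2), (C1 `&` C2); split; [exact: historyI|exact: measurableI|].
  by rewrite preimage_setI setIACA.
- move=> _ [A [C [hA mC ->]]].
  change (P (A `&` noise X i @^-1` C `&` prog X i @^-1` [set f]) =
      (p%:E * P (A `&` noise X i @^-1` C))%E).
  by rewrite setIC; exact: prog_noise_independent.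
- move=> _; apply: le_lt_trans (ltry 1); rewrite /= /mrestr setTI.
  exact: (@probability_le1 _ _ _ P).
Qed.

(** A free [phi] lets one bound serve twice: the constant 1 gives the deviation of the run counts, a
    truncation of the identity that of the noise sums. *)
Lemma noise_deviation (K a : R) : 0 <= K -> (forall x, `|phi x| <= K) -> 0 < a ->
  (P [set w | (a <= `|\sum_(i < n) ((prog X i w == f)%:R - p) * phi (noise X i w)|)%R]
   <= (n%:R * K ^+ 2 / a ^+ 2)%:E)%E.
Proof.
move=> K0 phiK a0.
apply: (@chebyshev_centered_sum _ _ _ P n p K b Y) => //.
- rewrite /p invr_ge0 ler0n /=.
  have [->|Pg] := posnP #|Prog|; first by rewrite invr0.
  by rewrite invf_le1 ?ltr0n ?ler1n.
- by move=> i iN; rewrite /b preimage_prog1; exact: measurable_prog.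
- by move=> i iN; apply: (measurableT_comp mphi); exact: (noise_measurable hX).
- by move=> i w _; exact: phiK.
- by move=> i B iN mB; exact: prog_centered_sum_independent.
Qed.

End noise_function.

(** * Run counts, the event that every program is run, and average noises *)

Lemma measurable_prog_eq (i : nat) (h : Prog) : (i < n)%N ->
  measurable_fun setT (fun w => (prog X i w == h)%:R : R).
Proof.
move=> iN; apply: measurable_fun_nat_of_bool.
by rewrite preimage_prog1; exact: measurable_prog.
Qed.

Lemma measurable_noise_deviation (phi : measurableTypeR R -> R) (h : Prog) :
  measurable_fun setT phi -> measurable_fun setT (fun w =>
    \sum_(i < n) ((prog X i w == h)%:R - p) * phi (noise X i w)).
Proof.
move=> mphi; apply: measurable_sum => i; apply: measurable_funM.
  by apply: measurable_funB => //; exact: measurable_prog_eq.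
by apply: (measurableT_comp mphi); exact: (noise_measurable hX).
Qed.

Lemma measurable_run_count (h : Prog) :
  measurable_fun setT (fun w => (run_count X n h w)%:R : R).
Proof.
rewrite (_ : (fun w => _) = (fun w => \sum_(i < n) (prog X i w == h)%:R)).
  by apply: measurable_sum => i; exact: measurable_prog_eq.
by apply/funext => w; rewrite natr_sum.
Qed.

Lemma measurable_run_avg_noise (h : Prog) :
  measurable_fun setT (run_avg X n (noise X) h).
Proof.
apply: measurable_funM.
  (* The inverse is rewritten as a measurable power; the two agree on all counts, both being 0 at
     0. *)
  rewrite (_ : (fun w => _) = (@powR R ^~ (-1)) \o (fun w => (run_count X n h w)%:R)).
    apply: measurableT_comp; [exact: measurable_powR|exact: measurable_run_count].
  by apply/funext => w /=; rewrite powR_inv1.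
apply: measurable_sum => i; apply: measurable_funM.
  exact: measurable_prog_eq.
exact: (noise_measurable hX).
Qed.

(** The factor 1 gives the sum the shape of [noise_deviation] with [phi] constant. *)
Lemma run_countE (h : Prog) (w : Omega) :
  (run_count X n h w)%:R =
    \sum_(i < n) ((prog X i w == h)%:R - p) * 1 + n%:R * p :> R.
Proof.
under eq_bigr do rewrite mulr1.
rewrite sumrB sumr_const card_ord -[p *+ n]mulr_natl subrK.
by rewrite /run_count natr_sum.
Qed.

Lemma run_count_deviation (h : Prog) (a : R) : 0 < a ->
  (P [set w | (a <= `|\sum_(i < n) ((prog X i w == h)%:R - p) * 1|)%R]
   <= (n%:R / a ^+ 2)%:E)%E.
Proof.
move=> a0.
have := @noise_deviation (cst 1) h
  (measurable_cst _) 1 a ler01 _ a0.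
by rewrite expr1n mulr1; apply => x; rewrite normr1.
Qed.

Lemma all_run_setC :
  ~` all_run X n = \big[setU/set0]_(h <- enum Prog)
    [set w | ((run_count X n h w)%:R <= 0 :> R)%R].
Proof.
apply/seteqP; split => w; rewrite -bigcup_seq.
  move/existsNP => [h /negP]; rewrite -leqNgt => h0.
  by exists h; rewrite /= ?mem_enum// lern0 -leqn0.
by case=> h _ /=; rewrite lern0 => /eqP h0 /(_ h); rewrite h0.
Qed.

Lemma measurable_all_run : measurable (all_run X n).
Proof.
rewrite -[all_run _ _]setCK all_run_setC; apply: measurableC.
apply: bigsetU_measurable => h _.
by apply: measurable_set_ler => //; exact: measurable_run_count.
Qed.

(** A program that is never run has a count deviating by [n * p] from its mean, which by Chebyshev
    has probability at most [#|Prog| ^ 2 / n]. The union bound gives [#|Prog| ^ 3 / n], at most one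
    half by assumption. *)
Lemma all_run_probability : (0 < #|Prog|)%N -> 2 * #|Prog|%:R ^+ 3 <= n%:R :> R ->
  ((2^-1)%:E <= P (all_run X n))%E.
Proof.
move=> Pg0 nP.
have P0 : 0 < #|Prog|%:R :> R by rewrite ltr0n.
have n0 : 0 < n%:R :> R by apply: lt_le_trans nP; rewrite mulr_gt0 ?exprn_gt0.
have p0 : 0 < p by rewrite invr_gt0.
suff : (P (~` all_run X n) <= (2^-1)%:E)%E.
  rewrite probability_setC; last exact: measurable_all_run.
  rewrite leeBlDr ?fin_num_measure//; last exact: measurable_all_run.
  rewrite -leeBlDl//; apply: le_trans.
  by rewrite -EFinB lee_fin; lra.
rewrite all_run_setC (le_trans (measure_bigsetU_le _ _ _))//.
  by move=> h; apply: measurable_set_ler => //; exact: measurable_run_count.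
apply: (@le_trans _ _ (\sum_(h <- enum Prog) (n%:R / (n%:R * p) ^+ 2)%:E)%E).
  apply: lee_sum => h _; apply: le_trans (run_count_deviation h (mulr_gt0 n0 p0)).
  apply: le_measure; rewrite ?inE.
  - by apply: measurable_set_ler => //; exact: measurable_run_count.
  - apply: measurable_set_ler => //; apply: measurableT_comp => //.
    by apply: (@measurable_noise_deviation (cst 1)).
  - move=> w /=; rewrite run_countE => h0.
    by rewrite ler_normr; apply/orP; right; lra.
rewrite sumEFin lee_fin big_const_seq count_predT -cardE iter_addr_0 -[leLHS]mulr_natl.
rewrite [leLHS](_ : _ = #|Prog|%:R ^+ 3 / n%:R); last first.
  by rewrite /p; field; rewrite !gt_eqF.
by rewrite ler_pdivrMr//; lra.
Qed.

(** Outside four events of probability at most [1 / L ^+ 2] each (a large [V] or [S], for [f] or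
    [g]) and a null event of large noise, both averages are within [4 * K * L / (p * s)] of the
    overall mean, where [s] is the square root of [n]. Adding the two errors and multiplying by [s]
    gives the threshold. *)
Lemma noise_avg_difference (K L : R) (f g : Prog) : 0 < K -> 0 < L ->
  (forall i, (i < n)%N -> P [set w | (K < `|noise X i w|)%R] = 0%E) ->
  (0 < n)%N -> L * Num.sqrt n%:R <= n%:R * p / 2 ->
  (P [set w | (8 * K * L / p < `|(run_avg X n (noise X) f w
        - run_avg X n (noise X) g w) / n%:R `^ (- 2^-1)|)%R]
    <= (4 / L ^+ 2)%:E)%E.
Proof.
move=> K0 L0 noiseK n0 Ln.
have P0 : 0 < #|Prog|%:R :> R by rewrite ltr0n; apply/card_gt0P; exists f.
have p0 : 0 < p by rewrite invr_gt0.
have nR0 : 0 < n%:R :> R by rewrite ltr0n.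
set s := Num.sqrt n%:R in Ln *.
have s0 : 0 < s by rewrite sqrtr_gt0.
have s2 : n%:R = s ^+ 2 by rewrite sqr_sqrtr// ltW.
(* The noise is bounded only almost surely, while the deviation bound requires a pointwise bound.
   The truncation is the identity outside the null event [large]. *)
pose clip (x : R) : R := (`|x| <= K)%R%:R * x.
have mclip : measurable_fun setT (clip : measurableTypeR R -> R).
  apply: measurable_funM => //; apply: measurable_fun_nat_of_bool.
  by apply: measurable_set_ler => //; exact: measurableT_comp.
have clipK x : `|clip x| <= K.
  rewrite /clip; case: (leP `|x| K) => xK; first by rewrite mul1r.
  by rewrite mul0r normr0 ltW.
pose V h w := \sum_(i < n) ((prog X i w == h)%:R - p) * 1.
pose S h w := \sum_(i < n) ((prog X i w == h)%:R - p) * clip (noise X i w).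
have mV h : measurable [set w | (L * s <= `|V h w|)%R].
  apply: measurable_set_ler => //; apply: measurableT_comp => //.
  by apply: (@measurable_noise_deviation (cst 1)).
have mS h : measurable [set w | (K * L * s <= `|S h w|)%R].
  apply: measurable_set_ler => //; apply: measurableT_comp => //.
  exact: measurable_noise_deviation.
have PV h : (P [set w | (L * s <= `|V h w|)%R] <= (1 / L ^+ 2)%:E)%E.
  apply: le_trans (run_count_deviation h (mulr_gt0 L0 s0)) _.
  by rewrite lee_fin s2 le_eqVlt; apply/orP; left; apply/eqP; field; rewrite !gt_eqF.
have PS h : (P [set w | (K * L * s <= `|S h w|)%R] <= (1 / L ^+ 2)%:E)%E.
  apply: le_trans (noise_deviation h mclip (ltW K0) clipK
    (mulr_gt0 (mulr_gt0 K0 L0) s0)) _.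
  by rewrite lee_fin s2 le_eqVlt; apply/orP; left; apply/eqP; field; rewrite !gt_eqF.
pose large := \big[setU/set0]_(i < n) [set w | (K < `|noise X i w|)%R].
have mlarge_i (i : 'I_n) : measurable [set w | (K < `|noise X i w|)%R].
  by apply: measurable_set_ltr => //; apply: measurableT_comp => //; exact: (noise_measurable hX).
have mlarge : measurable large by exact: bigsetU_measurable.
have Plarge : P large = 0%E.
  apply/eqP; rewrite eq_le measure_ge0 andbT.
  apply: le_trans (measure_bigsetU_le _ _ mlarge_i) _.
  by rewrite big1// => i _; exact: noiseK.
pose bad h := [set w | (L * s <= `|V h w|)%R] `|` [set w | (K * L * s <= `|S h w|)%R].
have mbad h : measurable (bad h) by exact: measurableU.
have Pbad h : (P (bad h) <= (2 / L ^+ 2)%:E)%E.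
  apply: le_trans (measureU2 _ (mV h) (mS h)) _.
  rewrite (_ : 2 / L ^+ 2 = 1 / L ^+ 2 + 1 / L ^+ 2); last by ring.
  by rewrite EFinD; apply: leeD; [exact: PV|exact: PS].
have avgE h w : ~ large w -> ~ bad h w ->
    `|run_avg X n (noise X) h w - (\sum_(i < n) noise X i w) / n%:R|
      <= 4 * K * L / (p * s).
  move=> Nlarge Nbad.
  have nK (i : 'I_n) : `|noise X i w| <= K.
    by rewrite leNgt; apply/negP => Ki; apply: Nlarge; rewrite /large -bigcup_seq;
      exists i => //=; rewrite mem_index_enum.
  apply: (@sample_mean_deviation _ p n%:R _ _ (S h w) (V h w)) => //.
  - exact: ltW.
  - exact: ltW.
  - exact: run_countE.
  - rewrite /S mulr_sumr -big_split/=; apply: eq_bigr => i _.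
    by rewrite /clip nK mul1r; ring.
  - by rewrite ltW// ltNge; apply/negP => ?; apply: Nbad; left.
  - by rewrite ltW// ltNge; apply/negP => ?; apply: Nbad; right.
  - rewrite (le_trans (ler_norm_sum _ _ _))//.
    rewrite (_ : _ * K = \sum_(i < n) K); last by rewrite sumr_const card_ord mulr_natl.
    exact: ler_sum.
apply: (@le_trans _ _ (P (large `|` (bad f `|` bad g)))).
  apply: le_measure; rewrite ?inE.
  - apply: measurable_set_ltr => //; apply: measurableT_comp => //.
    by apply: measurable_funM => //; apply: measurable_funB; exact: measurable_run_avg_noise.
  - by apply: measurableU => //; exact: measurableU.
  - move=> w /= far; apply: contrapT => /not_orP[Nl /not_orP[Nf Ng]].
    (* Dividing by the rate amounts to multiplying by [s]. *)
    move: far; rewrite powRN powR12_sqrt ?ler0n// invrK -/s ltNge => /negP; apply.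
    set m := (\sum_(i < n) noise X i w) / n%:R in avgE *.
    rewrite normrM (gtr0_norm s0) -ler_pdivlMr//.
    have /(_ w Nl Nf) hf := avgE f; have /(_ w Nl Ng) hg := avgE g.
    rewrite (_ : _ - _ = (run_avg X n (noise X) f w - m)
      - (run_avg X n (noise X) g w - m)); last by ring.
    rewrite (le_trans (ler_normB _ _))// (le_trans (lerD hf hg))//.
    by rewrite le_eqVlt; apply/orP; left; apply/eqP; field; rewrite !gt_eqF.
apply: le_trans (measureU2 _ mlarge (measurableU _ _ (mbad f) (mbad g))) _.
rewrite (_ : 4 / L ^+ 2 = 0 + (2 / L ^+ 2 + 2 / L ^+ 2)); last by ring.
rewrite !EFinD; apply: leeD; first by rewrite le_eqVlt; apply/orP; left; apply/eqP.
by apply: le_trans (measureU2 _ (mbad f) (mbad g)) _; apply: leeD; exact: Pbad.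
Qed.

End uniform_policy_experiment.

(* The true run time of each program lies in a fixed bounded set with positive
   probability; as it is conditionally independent of the noise, a noise that is
   too large would make the measurement exceed its essential bound. *)
Section noise_bound.
Context (R : realType) (Conf : Type) (Prog : finType) (dU : measure_display)
  (U : measurableType dU) (M : measurement_model R Conf Prog U) (c : Conf).

Lemma noise_bounded (B : R) : exists2 K : R, 0 < K &
  forall (dO : measure_display) (Omega : measurableType dO)
    (P : probability Omega R) (X : run_process R Prog U Omega) (n i : nat),
  delta_experiment P X M c (@uniform_policy R Prog n) n -> (i < n)%N ->
  {ae P, forall w, `|meas X i w| <= B} ->
  P [set w | (K < `|noise X i w|)%R] = 0%E.
Proof.
(* The constants depend only on [M], [c] and [B] and are fixed before any experiment, so [K] is
   uniform in the run and in [n]. *)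
have [L L_] := choice (fun h => probability_bounded_gt0 (rtime_law M c h)).
pose L1 := \sum_(h : Prog) `|L h|.
have L1ge h : L h <= L1.
  rewrite (le_trans (ler_norm _))// /L1 (bigD1 h)//= lerDl.
  by apply: sumr_ge0 => ? _.
have L10 : 0 <= L1 by apply: sumr_ge0 => ? _.
(* A noise beyond [K] with a true run time within [L1] forces a measurement beyond [B]; the summand
   1 makes [K] positive. *)
pose K := `|B| + L1 + 1.
exists K; first by rewrite ltr_wpDl ?addr_ge0.
move=> dO Omega P X n i hX iN [N [mN PN0 BN]].
pose near0 := [set x : measurableTypeR R | `|x| <= L1].
pose far := [set x : measurableTypeR R | K < `|x|].
have mnear0 : measurable near0.
  by apply: measurable_set_ler => //; exact: measurableT_comp.
have mfar : measurable far.
  by apply: measurable_set_ltr => //; exact: measurableT_comp.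
have mnoise : measurable (noise X i @^-1` far).
  by rewrite -[X in measurable X]setTI; exact: (noise_measurable hX).
have mrtime : measurable (rtime X i @^-1` near0).
  by rewrite -[X in measurable X]setTI; exact: (rtime_measurable hX).
have mp h : measurable (prog X i @^-1` [set h]) by exact: (measurable_prog hX).
have near0_gt0 h : (0 < rtime_law M c h near0)%E.
  apply: lt_le_trans (L_ h) _; apply: le_measure; rewrite ?inE//.
    by apply: measurable_set_ler => //; exact: measurableT_comp.
  by move=> x /= xL; exact: le_trans (L1ge h).
have far0 h : P (prog X i @^-1` [set h] `&` noise X i @^-1` far) = 0%E.
  have hF : history X i.+1 i.+1 i (prog X i @^-1` [set h]) by exact: history_prog.
  have := rtime_noise_cond_law hX iN hF mnear0 mfar.
  (* This event lies in the null set [N] where the essential bound may fail. *)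
  have -> : P (prog X i @^-1` [set h] `&` rtime X i @^-1` near0 `&`
      noise X i @^-1` far) = 0%E.
    apply/eqP; rewrite eq_le measure_ge0 andbT -PN0.
    apply: le_measure; rewrite ?inE//.
      by apply: measurableI => //; exact: measurableI.
    move=> w [[_ /= wn] wf]; apply: BN => /= wB.
    move: wf; rewrite /far /= ltNge => /negP; apply.
    rewrite (_ : noise X i w = meas X i w - rtime X i w); last first.
      by rewrite (additive_effect hX)// addrC addKr.
    rewrite (le_trans (ler_normB _ _))// /K -addrA lerD//.
      by rewrite (le_trans wB)// ler_norm.
    by rewrite (le_trans wn)// lerDl.
  (* The program is fixed on this event, so the mass that the true run time gives to [near0] factors
     out. As it is positive, the other factor must vanish. *)
  have -> : (\int[P]_(w in prog X i @^-1` [set h])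
      (rtime_law M c (prog X i w) near0 * noise_law M c (state X i w) far) =
      rtime_law M c h near0 * \int[P]_(w in prog X i @^-1` [set h])
        noise_law M c (state X i w) far)%E.
    rewrite -ge0_integralZl//.
    - by apply: eq_integral => w; rewrite inE /= => ->.
    - apply: measurable_funTS.
      apply: (measurableT_comp (measurable_kernel (noise_law M c) far mfar)).
      exact: (state_measurable hX).
  rewrite -(noise_law_history hX iN hF mfar) => /esym/eqP.
  by rewrite mule_eq0 gt_eqF ?near0_gt0//= => /eqP.
apply/eqP; rewrite eq_le measure_ge0 andbT.
rewrite (_ : [set w | _] = \big[setU/set0]_(h <- enum Prog)
    (prog X i @^-1` [set h] `&` noise X i @^-1` far)).
  apply: le_trans (measure_bigsetU_le _ _ _) _.
    by move=> h; exact: measurableI.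
  by rewrite big1// => h _; exact: far0.
apply/seteqP; split => [w wf|w].
  by rewrite -bigcup_seq; exists (prog X i w) => //=; rewrite mem_enum.
by rewrite -bigcup_seq => -[h _ []].
Qed.

End noise_bound.

(** * Choice of constants and passage to the conditional probability *)

Theorem theorem37 (R : realType) (Conf : Type) (Prog : finType)
    (hProg : (2 <= #|Prog|)%N)
    (dU : measure_display) (U : measurableType dU)
    (M : measurement_model R Conf Prog U) (c : Conf)
    (dO : nat -> measure_display)
    (Omega : forall n : nat, measurableType (dO n))
    (P : forall n : nat, probability (Omega n) R)
    (X : forall n : nat, run_process R Prog U (Omega n))
    (hX : alpha_design P X M c)
    (f g : Prog) (hfg : f != g) :
  big_O_p
    (fun n => cond_pr (P n) (all_run (X n) n))
    (fun n w => run_avg (X n) n (noise (X n)) f w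
                - run_avg (X n) n (noise (X n)) g w)
    (fun n => n%:R `^ (- 2^-1)).
Proof.
case: hX => _ hexp [B measB].
have [K K0 noiseK] := noise_bounded M c B.
have Pg0 : (0 < #|Prog|)%N by apply: ltn_trans hProg.
have P0 : 0 < #|Prog|%:R :> R by rewrite ltr0n.
set p : R := #|Prog|%:R^-1.
have p0 : 0 < p by rewrite invr_gt0.
move=> eps eps0.
(* Chosen so that [2 * (4 / L ^+ 2) = eps], the factor 2 being the cost of conditioning. *)
pose L := Num.sqrt (8 / eps).
have L0 : 0 < L by rewrite sqrtr_gt0 divr_gt0.
have L2 : L ^+ 2 = 8 / eps by rewrite sqr_sqrtr// ltW// divr_gt0.
exists (8 * K * L / p); split; first by rewrite divr_gt0 ?mulr_gt0.
near=> n.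
have nR0 : 0 < n%:R :> R by apply: (@lt_le_trans _ _ 1) => //; near: n; exact: nbhs_infty_ger.
have n3 : 2 * #|Prog|%:R ^+ 3 <= n%:R :> R by near: n; exact: nbhs_infty_ger.
(* Taking square roots, this becomes the condition [L * Num.sqrt n%:R <= n%:R * p / 2], which keeps
   the counts of order [n]. *)
have nL : (2 * L / p) ^+ 2 <= n%:R by near: n; exact: nbhs_infty_ger.
have half := all_run_probability (hexp n) Pg0 n3.
have mrun := measurable_all_run (hexp n).
have Ln : L * Num.sqrt n%:R <= n%:R * p / 2.
  have -> : n%:R = Num.sqrt n%:R ^+ 2 :> R by rewrite sqr_sqrtr// ltW.
  rewrite sqrtr_sqr ger0_norm ?sqrtr_ge0//.
  have : 2 * L / p <= Num.sqrt n%:R.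
    rewrite -(ger0_norm (_ : 0 <= 2 * L / p)) ?divr_ge0 ?mulr_ge0 ?(ltW L0) ?(ltW p0)//.
    by rewrite -sqrtr_sqr ler_wsqrtr.
  rewrite ler_pdivrMr// => h; rewrite (_ : _ ^+ 2 * p / 2 =
    Num.sqrt n%:R * p / 2 * Num.sqrt n%:R); last by ring.
  by rewrite ler_wpM2r ?sqrtr_ge0//; lra.
have bound := @noise_avg_difference _ _ _ _ _ _ _ _ _ _ _ _ (hexp n) K L f g
  K0 L0 (fun i iN => noiseK _ _ _ _ _ _ (hexp n) iN (measB n i iN)) _ Ln.
have fP : P n (all_run (X n) n) \is a fin_num by exact: fin_num_measure.
have half' : 2^-1 <= fine (P n (all_run (X n) n)) by rewrite -lee_fin fineK.
rewrite /cond_pr.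
have mbad : measurable [set w | (8 * K * L / p < `|(run_avg (X n) n (noise (X n)) f w
        - run_avg (X n) n (noise (X n)) g w) / n%:R `^ (- 2^-1)|)%R].
  apply: measurable_set_ltr => //; apply: measurableT_comp => //.
  by apply: measurable_funM => //; apply: measurable_funB;
    exact: (measurable_run_avg_noise (hexp n)).
(* Conditioning drops the intersection with [all_run] and divides by a probability of at least one
   half. *)
apply: (@le_trans _ _ ((4 / L ^+ 2)%:E * 2%:E)%E).
  apply: lee_pmul => //.
  - by rewrite lee_fin invr_ge0 fine_ge0.
  - apply: le_trans (bound _); last by rewrite -(ltr0n R).
    by apply: le_measure; rewrite ?inE//; exact: measurableI.
  - by rewrite lee_fin -[leRHS]invrK lef_pV2 ?posrE//; apply: lt_le_trans half'.
rewrite -EFinM lee_fin L2 le_eqVlt; apply/orP; left; apply/eqP.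
by field; rewrite gt_eqF.
Unshelve. all: by end_near.
Qed.
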